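(* Let $q=p^e$ with $p$ an odd prime and $e\ge1$, let $m\ge3$ be odd, and let $l=\frac{e(p-1)(m+3)}{4}$. Let $D=\{x\in\mathbb{F}_{q^m}:\mathrm{Tr}_{q^m/q}(x^2)=0\}$ and $\overline{\mathcal{C}_D}=\{(\mathrm{Tr}_{q^m/q}(bx)+c)_{x\in D}:b\in\mathbb{F}_{q^m},c\in\mathbb{F}_q\}$. Then $\overline{\mathcal{C}_D}$ is a $[q^{m-1},\ m+1,\ (q-1)q^{\frac{m-3}{2}}(q^{\frac{m-1}{2}}-1)]$ code over $\mathbb{F}_q$ with weight distribution: weight $0$ with frequency $1$; weight $q^{m-1}$ with frequency $q-1$; weight $(q-1)q^{m-2}$ with frequency $q(q^{m-1}-1)$; weight $(q-1)q^{m-2}+(-1)^lq^{\frac{m-3}{2}}$ with frequency $\frac{(q-1)^2(q^{m-1}+(-1)^lq^{\frac{m-1}{2}})}{2}$; weight $(q-1)q^{m-2}-(-1)^lq^{\frac{m-3}{2}}$ with frequency $\frac{(q-1)^2(q^{m-1}+(-1)^{l+1}q^{\frac{m-1}{2}})}{2}$; weight $(q-1)q^{m-2}-(-1)^l(q-1)q^{\frac{m-3}{2}}$ with frequency $\frac{(q-1)(q^{m-1}+(-1)^lq^{\frac{m-1}{2}})}{2}$; weight $(q-1)q^{m-2}+(-1)^l(q-1)q^{\frac{m-3}{2}}$ with frequency $\frac{(q-1)(q^{m-1}+(-1)^{l+1}q^{\frac{m-1}{2}})}{2}$. In particular, $\overline{\mathcal{C}_D}$ is self-orthogonal for $m>3$.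 Moreover, $\overline{\mathcal{C}_D}^{\perp}$ has parameters $[q^{m-1},\ q^{m-1}-m-1,\ 3]$ and is at least almost optimal according to the sphere-packing bound.
   Context: $\mathrm{Tr}_{q^m/q}$ is the trace map from $\mathbb{F}_{q^m}$ to $\mathbb{F}_q$. An $[n,k,d]$ code is optimal if no $[n,k,d+1]$ code exists and almost optimal if an optimal $[n,k,d+1]$ code exists; ''at least almost optimal according to the sphere-packing bound'' means the sphere-packing bound rules out an $[n,k,d+2]$ code. Self-orthogonal means $\mathcal{C}\subseteq\mathcal{C}^\perp$. *)

(* Defs.v *)
From HB Require Import structures.
From mathcomp Require Import all_boot all_order all_algebra.
Set Implicit Arguments. Unset Strict Implicit. Unset Printing Implicit Defensive.
Import Order.TTheory GRing.Theory Num.Theory.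
Local Open Scope ring_scope.

(* Tr_{q^m/q}, with F = F_q embedded in L = F_{q^m} by iota, q = #|F|:
   the unique c in F with iota c = sum_{i<m} x^(q^i). *)
Definition trace (F L : finFieldType) (iota : {rmorphism F -> L}) (m : nat)
  (x : L) : F :=
  odflt 0 [pick c : F | iota c == \sum_(i < m) x ^+ (#|F| ^ i)%N].

Definition Dset (F L : finFieldType) (iota : {rmorphism F -> L}) (m : nat)
  : {set L} := [set x : L | trace iota m (x ^+ 2) == 0].

Definition cwD (F L : finFieldType) (iota : {rmorphism F -> L}) (m : nat)
  (b : L) (c : F) : 'rV[F]_#|Dset iota m| :=
  \row_(i < #|Dset iota m|) (trace iota m (b * enum_val i) + c).

Definition CDbar (F L : finFieldType) (iota : {rmorphism F -> L}) (m : nat)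
  : {set 'rV[F]_#|Dset iota m|} :=
  [set cwD iota m b c | b : L, c : F].

Definition wt (F : finFieldType) (n : nat) (v : 'rV[F]_n) : nat :=
  #|[set i : 'I_n | v 0 i != 0]|.

Definition lin_code (F : finFieldType) (n : nat) (C : {set 'rV[F]_n}) : Prop :=
  0 \in C /\ forall (a : F) (u v : 'rV[F]_n), u \in C -> v \in C -> a *: u + v \in C.

Definition code_dim (F : finFieldType) (n : nat) (C : {set 'rV[F]_n}) : nat :=
  \dim <<enum C>>%VS.

Definition min_dist (F : finFieldType) (n : nat) (C : {set 'rV[F]_n}) (d : nat)
  : Prop :=
  (exists2 c, c \in C & (c != 0) && (wt c == d)) /\
  (forall c, c \in C -> c != 0 -> (d <= wt c)%N).

Definition is_nkd (F : finFieldType) (n : nat) (C : {set 'rV[F]_n}) (k d : nat)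
  : Prop := lin_code C /\ code_dim C = k /\ min_dist C d.

Definition freqz (F : finFieldType) (n : nat) (C : {set 'rV[F]_n}) (w : int)
  : nat := #|[set c in C | (wt c)%:Z == w]|.

Definition dual_code (F : finFieldType) (n : nat) (C : {set 'rV[F]_n})
  : {set 'rV[F]_n} := [set v : 'rV[F]_n | [forall c in C, v *m c^T == 0]].

Definition self_orthogonal (F : finFieldType) (n : nat) (C : {set 'rV[F]_n})
  : Prop := C \subset dual_code C.

(* The sphere-packing bound rules out an [n,k,d] code over F_q:
   q^k * |ball of radius floor((d-1)/2)| > q^n. *)
Definition sphere_packing_rules_out (q n k d : nat) : Prop :=
  (q ^ n < q ^ k * \sum_(i < ((d - 1) %/ 2).+1) 'C(n, i) * (q - 1) ^ i)%N.

(* Main.v *)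
Require Import Defs.
From HB Require Import structures.
From mathcomp Require Import all_boot all_order all_algebra.
From mathcomp Require Import all_fingroup all_solvable all_field all_character.
From mathcomp Require Import zify ring.
Set Implicit Arguments.
Unset Strict Implicit.
Unset Printing Implicit Defensive.
Import Order.TTheory GRing.Theory Num.Theory.
Local Open Scope ring_scope.

(** Since [x ^ 2 = y] has [1 + eta y] solutions, the number of x with
    tr (x ^ 2) = a is q ^ (m - 1) + S a, where S a is the sum of the quadratic
    character eta of L over the hyperplane tr y = a.  As m is odd, eta restricts
    to the quadratic character of F, so S (t a) = eta t * S a; hence S 0 = 0, and
    a second-moment computation gives S 1 = d q ^ ((m - 1) / 2) with d = 1 or -1.
    Stereographic projection of the quadric tr (x ^ 2) = tr (b ^ 2) from b
    converts this into the size of D on each hyperplane tr (b x) = c, that is,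
    into the weights.  The weight of a codeword depends on d only through
    d * eta (tr (b ^ 2)), and so the table of frequencies is the same for both
    values of d. *)

(** * The quadratic character *)

Lemma card_fibres (A B : finType) (P : {pred A}) (f : A -> B) :
  #|[set x | P x]| = (\sum_y #|[set x | P x && (f x == y)]|)%N.
Proof.
rewrite -sum1_card (eq_bigl P) => [|x]; last by rewrite inE.
rewrite (partition_big f predT) //=; apply: eq_bigr => y _.
by rewrite -sum1_card; apply: eq_bigl => x; rewrite inE.
Qed.

(** Euler's criterion serves as the definition, which reduces multiplicativity to that of a power
    map; the values lie in [int] so that character sums can count points. *)
Definition qchar {K : finFieldType} (y : K) : int :=
  if y == 0 then 0 else if y ^+ #|K|.-1./2 == 1 then 1 else -1.

Section QuadraticCharacter.

Variable K : finFieldType.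
Hypothesis oddK : odd #|K|.
Implicit Types x y : K.

Lemma card_gt1 : (1 < #|K|)%N.
Proof. exact: card_finNzRing_gt1. Qed.

Lemma double_half_card : (#|K|.-1./2 * 2 = #|K|.-1)%N.
Proof. by have := card_gt1; lia. Qed.

Lemma natr_card0 : #|K|%:R = 0 :> K.
Proof.
have := @expg_cardG K [set: K]%G 1%R (in_setT _).
by rewrite FinRing.zmodXgE cardsT.
Qed.

Lemma two_neq0 : 2%:R != 0 :> K.
Proof.
apply/eqP => two0; have := natr_card0.
rewrite -(odd_double_half #|K|) oddK natrD -mul2n natrM two0 mul0r addr0.
by move/eqP; rewrite oner_eq0.
Qed.

Lemma oppf_eq x : (- x == x) = (x == 0).
Proof.
rewrite -subr_eq0 -opprD oppr_eq0 -mulr2n -mulr_natl mulf_eq0.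
by rewrite (negPf two_neq0).
Qed.

Lemma qchar0 : qchar (0 : K) = 0. Proof. by rewrite /qchar eqxx. Qed.

Lemma expf_half y : y != 0 -> (y ^+ #|K|.-1./2 == 1) || (y ^+ #|K|.-1./2 == -1).
Proof.
move=> y0; rewrite -eqf_sqr expr1n -exprM double_half_card.
apply/eqP/(mulfI y0); rewrite mulr1 -exprS prednK ?expf_card //.
exact: ltnW (card_gt1).
Qed.

Lemma qcharM x y : qchar (x * y) = qchar x * qchar y.
Proof.
rewrite /qchar mulf_eq0; have [->|x0] := eqVneq x 0; first by rewrite /= mul0r.
have [->|y0] := eqVneq y 0; first by rewrite /= mulr0.
have N1 : (-1 == 1 :> K) = false by rewrite oppf_eq oner_eq0.
rewrite /= exprMn; case/orP: (expf_half x0) => /eqP->;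
  case/orP: (expf_half y0) => /eqP->; by rewrite ?mul1r ?mulr1 ?mulrNN ?mulr1 ?N1 ?eqxx.
Qed.

Lemma qchar_sqr x : x != 0 -> qchar (x ^+ 2) = 1.
Proof.
rewrite expr2 qcharM /qchar => /negPf->.
by case: ifP.
Qed.

Lemma qchar_sqr1 y : y != 0 -> qchar y ^+ 2 = 1.
Proof. by move=> y0; rewrite expr2 -qcharM qchar_sqr. Qed.

Lemma card_sqrt_sqr x : x != 0 -> #|[set z : K | z ^+ 2 == x ^+ 2]| = 2%N.
Proof.
move=> x0; have -> : [set z | z ^+ 2 == x ^+ 2] = [set x; - x].
  by apply/setP=> z; rewrite !inE eqf_sqr.
by rewrite cards2 eq_sym oppf_eq x0.
Qed.

(** Inclusion plus a count. Squaring is two-to-one on the nonzero elements, so there are [h] nonzero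
    squares; they are roots of [X^h - 1], which has at most [h] roots. *)
Lemma sqr_set : [set x ^+ 2 | x in [set~ (0 : K)]] = [set y | y ^+ #|K|.-1./2 == 1].
Proof.
set h := #|K|.-1./2; set S := imset _ _; set T := finset _.
have h0 : (0 < h)%N by have := card_gt1; move: double_half_card; rewrite -/h; lia.
have cS : (#|S| = h)%N.
  apply/eqP; rewrite -(@eqn_pmul2r 2) // /h double_half_card.
  rewrite -(cardsC1 (0 : K)) -[X in _ == X]sum1_card.
  rewrite (partition_big_imset (fun x => x ^+ 2)) /= -/S -sum_nat_const; apply/eqP.
  apply: eq_bigr => y /imsetP[x]; rewrite !inE => x0 ->.
  rewrite -[LHS](card_sqrt_sqr x0) -sum1_card; apply: eq_bigl => z.
  rewrite !inE; have [->|//] := eqVneq z 0.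
  by rewrite expr0n eq_sym expf_eq0 (negPf x0).
apply/eqP; rewrite eqEcard; apply/andP; split.
  apply/subsetP=> y /imsetP[x]; rewrite !inE => x0 ->.
  rewrite -exprM mulnC double_half_card.
  apply/eqP/(mulfI x0); rewrite mulr1 -exprS prednK ?expf_card //.
  exact: ltnW (card_gt1).
rewrite cS -ltnS -(size_XnsubC (1 : K) h0) cardE.
apply: max_poly_roots; first by rewrite -size_poly_eq0 size_XnsubC.
  by apply/allP=> y; rewrite mem_enum inE rootE !hornerE subr_eq0.
exact: enum_uniq.
Qed.

Lemma card_sqrt y : (#|[set x : K | x ^+ 2 == y]|)%:Z = 1 + qchar y.
Proof.
have [->|y0] := eqVneq y 0.
  have -> : [set x : K | x ^+ 2 == 0] = [set 0].
    by apply/setP=> x; rewrite !inE sqrf_eq0.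
  by rewrite cards1 qchar0.
rewrite /qchar (negPf y0); case: ifP => yh.
  have : y \in [set x ^+ 2 | x in [set~ (0 : K)]] by rewrite sqr_set inE.
  by case/imsetP=> x; rewrite !inE => x0 ->; rewrite card_sqrt_sqr.
rewrite eq_card0 // => x; rewrite inE; apply/negP=> /eqP xy.
move: yh; have : y \in [set x ^+ 2 | x in [set~ (0 : K)]].
  by rewrite -xy; apply: imset_f; rewrite !inE; apply: contraNneq y0 => x0; rewrite -xy x0 expr0n.
by rewrite sqr_set inE => ->.
Qed.

(** Sorting all elements of [K] by their squares expresses [#|K|] as the sum of [1 + qchar y]. *)
Lemma sum_qchar : \sum_(y : K) qchar y = 0.
Proof.
have /(congr1 Posz) := @card_fibres K K predT (fun x => x ^+ 2).
rewrite (big_morph Posz (id1 := 0) (op1 := +%R)) //.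
under eq_bigr do rewrite card_sqrt.
rewrite big_split /= sumr_const cardsT.
have -> : 1 *+ #|K| = #|K|%:Z by rewrite -natz.
by move=> E; apply: (addrI #|K|%:Z); rewrite addr0.
Qed.

Lemma qchar_val y : y != 0 -> (qchar y == 1) || (qchar y == -1).
Proof. by rewrite /qchar => /negPf->; case: ifP. Qed.

(** On nonzero [y], [qchar y ^+ 2 + s * qchar y] is 2 if [qchar y = s] and 0 otherwise; by
    [sum_qchar] its total is the number of nonzero elements. *)
Lemma card_qchar (s : int) : s ^+ 2 = 1 ->
  2 * (#|[set y : K | qchar y == s]|)%:Z = #|K|%:Z - 1.
Proof.
move=> s2.
have -> : #|K|%:Z - 1 = (#|[set~ (0 : K)]|)%:Z.
  by rewrite cardsC1 predn_int // (ltnW card_gt1).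
have E : \sum_(y : K) (qchar y ^+ 2 + s * qchar y) = \sum_(y in [set~ (0 : K)]) 1.
  rewrite big_split /= -mulr_sumr sum_qchar mulr0 addr0 (bigD1 0) //= qchar0.
  rewrite expr0n add0r; apply: eq_big => y; first by rewrite !inE.
  exact: qchar_sqr1.
transitivity (\sum_(y in [set~ (0 : K)]) (1 : int)); last by rewrite sumr_const natz.
rewrite -E (bigID (fun y => qchar y == s)) /= [X in _ + X]big1 ?addr0; last first.
  move=> y /negPf ys; have [->|y0] := eqVneq y 0; first by rewrite qchar0 mulr0.
  have : (s == 1) || (s == -1) by rewrite -eqf_sqr s2 expr1n.
  case/orP: (qchar_val y0) ys => /eqP->; rewrite eq_sym => ys /orP[]/eqP sE;
    by move: ys; rewrite sE.
rewrite (eq_bigr (fun _ => 2)) => [|y /eqP->]; last by rewrite -expr2 s2.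
rewrite big_const -cardsE; elim: #|_| => //= k IH; rewrite -IH; lia.
Qed.

End QuadraticCharacter.

(** * The trace *)

Section Trace.

Variables (F L : finFieldType) (iota : {rmorphism F -> L}) (m : nat).
Hypotheses (m_gt0 : (0 < m)%N) (cardL : #|L| = (#|F| ^ m)%N).
Local Notation q := #|F|.
Local Notation tr := (trace iota m).
Implicit Types (x y b : L) (a c : F).

Lemma pchar_nat_card : [pchar L].-nat q.
Proof.
have [p pr_p pL] := finPcharP L.
have : p.-nat #|L| by rewrite (card_pprimeChar pL) pnatX pnat_id.
rewrite cardL pnatX eqn0Ngt m_gt0 orbF.
by rewrite (eq_pnat _ (pcharf_eq pL)).
Qed.

Lemma expfqD i x y : (x + y) ^+ (q ^ i) = x ^+ (q ^ i) + y ^+ (q ^ i).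
Proof. by rewrite exprDn_pchar // pnatX pchar_nat_card. Qed.

Lemma expf_cardX a i : a ^+ (q ^ i) = a.
Proof. by elim: i => [|i IH]; rewrite ?expn0 ?expr1 // expnS exprM expf_card. Qed.

(** [X^q - X] is the product of the [X - c] over [F]; evaluating its image over [L] at [y] shows
    that [y] is some [iota c]. *)
Lemma fixed_in_base y : y ^+ q = y -> exists c, iota c = y.
Proof.
move=> yq; have := congr1 (fun P => (map_poly iota P).[y]) (finField_genPoly F).
rewrite rmorphB /= map_polyXn map_polyX !hornerE yq subrr.
rewrite rmorph_prod horner_prod => /esym/eqP/prodf_eq0[c _].
rewrite rmorphB /= map_polyX map_polyC !hornerE subr_eq0 => /eqP->.
by exists c.
Qed.

(** The default in [trace] is never reached: since [x ^+ (q ^ m) = x], the q-power map permutes the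
    summands cyclically, so the sum is fixed and lies in the image of [iota]. *)
Lemma iota_trace x : iota (tr x) = \sum_(i < m) x ^+ (q ^ i).
Proof.
rewrite /trace; case: pickP => [c /eqP//|none].
have [|c cE] := @fixed_in_base (\sum_(i < m) x ^+ (q ^ i)).
  have qD u v : (u + v) ^+ q = u ^+ q + v ^+ q :> L by have := expfqD 1 u v; rewrite expn1.
  have q0 : 0 ^+ q = 0 :> L by rewrite expr0n eqn0Ngt ltnW // card_gt1.
  rewrite (big_morph (fun u => u ^+ q) qD q0).
  have xL : x ^+ (q ^ m) = x by rewrite -cardL expf_card.
  case: m m_gt0 xL => // k _ xL; rewrite big_ord_recr big_ord_recl /=.
  rewrite -exprM -expnSr xL expn0 expr1 addrC; congr (_ + _).
  by apply: eq_bigr => i _; rewrite -exprM -expnSr.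
by have := none c; rewrite cE eqxx.
Qed.

Lemma traceD x y : tr (x + y) = tr x + tr y.
Proof.
apply: (fmorph_inj iota); rewrite rmorphD !iota_trace -big_split.
by apply: eq_bigr => i _; rewrite expfqD.
Qed.

Lemma traceZ a x : tr (iota a * x) = a * tr x.
Proof.
apply: (fmorph_inj iota); rewrite rmorphM !iota_trace mulr_sumr.
by apply: eq_bigr => i _; rewrite exprMn -rmorphXn expf_cardX.
Qed.

Lemma trace0 : tr 0 = 0.
Proof. by have := traceZ 0 0; rewrite mulr0 mul0r. Qed.

Lemma traceN x : tr (- x) = - tr x.
Proof. by have := traceZ (-1) x; rewrite rmorphN1 !mulN1r. Qed.

(** As a polynomial the trace has degree [q ^ m.-1], less than [#|L|], so it cannot vanish on all of
    [L]. *)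
Lemma trace_neq0 : exists x, tr x != 0.
Proof.
apply/existsP; apply: contraT; rewrite negb_exists => /forallP tr0.
pose P : {poly L} := \sum_(i < m) 'X^(q ^ i).
have sP : size P = (q ^ m.-1).+1.
  rewrite /P; case: m m_gt0 => // k _; rewrite big_ord_recr /=.
  rewrite addrC size_polyDl size_polyXn // ltnS.
  apply: leq_trans (size_sum _ _ _) _; apply/bigmax_leqP => i _.
  by rewrite size_polyXn ltn_exp2l // card_gt1.
have := @max_poly_roots _ P (enum L); rewrite -cardE sP cardL ltnS.
have -> : (q ^ m <= q ^ m.-1)%N = false.
  by rewrite leq_exp2l ?card_gt1 //; case: m m_gt0 => //= k _; rewrite ltnn.
apply=> [||].
- by rewrite -size_poly_eq0 sP.
- apply/allP=> x _; rewrite rootE horner_sum.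
  under eq_bigr do rewrite hornerXn.
  by rewrite -iota_trace fmorph_eq0; have := tr0 x; rewrite negbK.
- exact: enum_uniq.
Qed.

Lemma trace_mul_onto b c : b != 0 -> exists x, tr (b * x) = c.
Proof.
move=> b0; have [x x0] := trace_neq0.
exists (iota (c / tr x) * (b^-1 * x)).
by rewrite mulrCA mulVKf // traceZ divfK.
Qed.

Lemma card_trace_fibre b c : b != 0 ->
  #|[set x | tr (b * x) == c]| = (q ^ (m - 1))%N.
Proof.
move=> b0.
have same d : #|[set x | tr (b * x) == d]| = #|[set x | tr (b * x) == c]|.
  have [z zE] := trace_mul_onto (d - c) b0.
  rewrite -(card_imset [set x | tr (b * x) == c] (addrI z)); apply: eq_card => x.
  rewrite inE; apply/eqP/imsetP => [xd|[y + ->]].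
    by exists (x - z); rewrite ?inE ?mulrBr ?traceD ?traceN ?xd ?zE ?subKr // addrC subrK.
  by rewrite inE mulrDr traceD zE => /eqP->; rewrite subrK.
have := @card_fibres L F predT (fun x => tr (b * x)).
rewrite cardsT cardL; under eq_bigr do rewrite same.
rewrite sum_nat_const; case: m m_gt0 => // k _; rewrite subn1 expnS /= => /eqP.
by rewrite eqn_pmul2l ?(ltnW (card_gt1 F)) // => /eqP->.
Qed.

End Trace.

(** * Points on quadrics *)

Lemma PoszX (a n : nat) : (a ^ n)%N%:Z = a%:Z ^+ n.
Proof. by rewrite -natz natrX natz. Qed.

Lemma sum_mulb_card (T : finType) (P : pred T) (z : int) :
  \sum_(x : T) (P x)%:R * z = (#|[set x | P x]|)%:Z * z.
Proof.
rewrite -mulr_suml; congr (_ * _).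
rewrite -sum1dep_card (big_morph Posz (id1 := 0) (op1 := +%R)) // [RHS]big_mkcond.
by apply: eq_bigr => x _; case: (P x).
Qed.

Lemma sum_bool_card (T : finType) (P : pred T) :
  \sum_(x : T) (P x)%:R = (#|[set x | P x]|)%:Z :> int.
Proof.
by rewrite -[RHS]mulr1 -sum_mulb_card; apply: eq_bigr => x _; rewrite mulr1.
Qed.

Section QuadricCount.

Variables (F L : finFieldType) (iota : {rmorphism F -> L}) (m : nat).
Hypotheses (cardL : #|L| = (#|F| ^ m)%N) (oddF : odd #|F|) (oddm : odd m).
Local Notation q := #|F|.
Local Notation Q := (#|F|%:Z).
Local Notation tr := (trace iota m).
Implicit Types (x y z b : L) (a c t : F).

Let m_gt0 : (0 < m)%N. Proof. exact: odd_gt0. Qed.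
Let oddL : odd #|L|. Proof. by rewrite cardL oddX oddF orbT. Qed.
Let trD := traceD iota m_gt0 cardL.
Let trZ := traceZ iota m_gt0 cardL.
Let tr0 := trace0 iota m_gt0 cardL.
Let trN := traceN iota m_gt0 cardL.
Let trB x y : tr (x - y) = tr x - tr y.
Proof. by rewrite trD trN. Qed.

(** The exponent for [L] is the one for [F] times [1 + q + ... + q^(m-1)], a sum of an odd number of
    odd terms, and an odd power leaves 1 and -1 unchanged. *)
Lemma qchar_iota a : qchar (iota a) = qchar a.
Proof.
have [->|a0] := eqVneq a 0; first by rewrite rmorph0 !qchar0.
rewrite /qchar fmorph_eq0 (negPf a0).
have odds k : odd (\sum_(i < k) q ^ i) = odd k.
  by elim: k => [|k IH]; rewrite ?big_ord0 // big_ord_recr oddD IH oddX oddF orbT addbT.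
have -> : (#|L|.-1./2 = q.-1./2 * \sum_(i < m) q ^ i)%N.
  by rewrite cardL predn_exp -[in LHS](double_half_card oddF) mulnAC muln2 doubleK.
rewrite -rmorphXn fmorph_eq1 exprM; case/orP: (expf_half oddF a0) => /eqP->.
  by rewrite expr1n.
by rewrite -signr_odd odds oddm expr1.
Qed.

(** The sum [S a] of the overview. *)
Definition trace_qsum a : int := \sum_(y | tr y == a) qchar y.

Lemma card_quadric_qsum a :
  (#|[set x | tr (x ^+ 2) == a]|)%:Z = Q ^+ (m - 1) + trace_qsum a.
Proof.
rewrite (@card_fibres L L (fun x => tr (x ^+ 2) == a) (fun x => x ^+ 2)).
rewrite (big_morph Posz (id1 := 0) (op1 := +%R)) //.
have -> : Q ^+ (m - 1) = \sum_(y | tr y == a) 1.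
  have := card_trace_fibre iota m_gt0 cardL a (oner_neq0 L).
  rewrite -sum1dep_card => /(congr1 Posz).
  rewrite (big_morph Posz (id1 := 0) (op1 := +%R)) // PoszX => <-.
  by apply: eq_bigl => y; rewrite mul1r.
rewrite -big_split /= [RHS]big_mkcond; apply: eq_bigr => y _; case: ifP => ya.
  rewrite -(card_sqrt oddL); congr Posz; apply: eq_card => x; rewrite !inE.
  by case: (x ^+ 2 =P y) => [->|]; rewrite ?ya ?andbF.
rewrite eq_card0 // => x; rewrite inE.
by case: (x ^+ 2 =P y) => [->|]; rewrite ?ya ?andbF.
Qed.

Lemma trace_qsumM t a : t != 0 -> trace_qsum (t * a) = qchar t * trace_qsum a.
Proof.
move=> t0; have it0 : iota t != 0 by rewrite fmorph_eq0.
rewrite /trace_qsum (reindex_inj (mulfI it0)) mulr_sumr.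
apply: eq_big => [y|y _]; first by rewrite trZ (inj_eq (mulfI t0)).
by rewrite qcharM // qchar_iota.
Qed.

Lemma trace_qsumE a : trace_qsum a = qchar a * trace_qsum 1.
Proof.
have [->|a0] := eqVneq a 0; last by rewrite -trace_qsumM ?mulr1.
rewrite qchar0 mul0r.
(* A nonsquare [t] turns [trace_qsumM] at 0 into [trace_qsum 0 = - trace_qsum 0]. *)
have /card_gt0P[t] : (0 < #|[set t : F | qchar t == (-1)%R]|)%N.
  by have := @card_qchar F oddF (-1)%R erefl; have := card_gt1 F; lia.
rewrite inE => /eqP qt.
have t0 : t != 0 by apply: contra_eq_neq qt => ->; rewrite qchar0.
have := trace_qsumM 0 t0; rewrite mulr0 qt mulN1r.
by move: (trace_qsum 0) => z zN; lia.
Qed.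

(* Summing the squares of [trace_qsum] over all traces and substituting z = y u
   reduces the double sum to counting hyperplanes. *)
Lemma trace_qsum1_sqr : trace_qsum 1 ^+ 2 = Q ^+ (m - 1).
Proof.
have cK u : (#|[set y | tr ((1 - u) * y) == 0]|)%:Z
    = Q ^+ (m - 1) + (u == 1)%:R * (Q ^+ m - Q ^+ (m - 1)).
  have [->|u1] := eqVneq u 1.
    rewrite mul1r [RHS]addrC subrK subrr -PoszX -cardL -cardsT.
    by congr Posz; apply: eq_card => y; rewrite !inE mul0r tr0 eqxx.
  rewrite (card_trace_fibre iota m_gt0 cardL) ?mul0r ?addr0 ?PoszX //.
  by rewrite subr_eq0 eq_sym.
have E1 : \sum_(a : F) trace_qsum a ^+ 2 = (Q - 1) * trace_qsum 1 ^+ 2.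
  transitivity (\sum_(a : F) (a != 0)%:R * trace_qsum 1 ^+ 2).
    apply: eq_bigr => a _; rewrite trace_qsumE exprMn; congr (_ * _).
    by have [->|a0] := eqVneq a 0; rewrite ?qchar0 ?qchar_sqr1.
  rewrite sum_mulb_card; congr (_ * _).
  have -> : [set x : F | x != 0] = [set~ 0] by apply/setP=> x; rewrite !inE.
  by rewrite cardsC1 predn_int // ltnW // card_gt1.
have E2 : \sum_(a : F) trace_qsum a ^+ 2 =
    \sum_(y : L) \sum_(z | tr z == tr y) qchar (y * z).
  rewrite [RHS](partition_big (fun y => tr y) predT) //=; apply: eq_bigr => a _.
  rewrite expr2 mulr_suml; apply: eq_bigr => y /eqP <-; rewrite mulr_sumr.
  by apply: eq_bigr => z _; rewrite qcharM.
have E3 : \sum_(y : L) \sum_(z | tr z == tr y) qchar (y * z) =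
    \sum_(u : L) ((#|[set y | tr ((1 - u) * y) == 0]|)%:Z - 1) * qchar u.
  (* The substitution [z = y * u] needs [y] nonzero; [y = 0] contributes nothing because
     [qchar 0 = 0]. *)
  transitivity (\sum_(y : L) \sum_(u : L) ((y != 0) && (tr ((1 - u) * y) == 0))%:R * qchar u).
    apply: eq_bigr => y _; have [->|y0] := eqVneq y 0.
      by rewrite !big1 // => [u _|z _]; rewrite mul0r ?qchar0.
    rewrite (reindex_inj (mulfI y0)) big_mkcond; apply: eq_bigr => u _ /=.
    rewrite mulrBl mul1r trB subr_eq0 [u * y]mulrC eq_sym.
    case: eqP => _; last by rewrite mul0r.
    by rewrite mul1r mulrA -expr2 qcharM // qchar_sqr // mul1r.
  rewrite exchange_big; apply: eq_bigr => u _.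
  rewrite sum_mulb_card; congr (_ * _).
  have /(congr1 Posz) := cardsD1 0 [set y | tr ((1 - u) * y) == 0].
  rewrite inE mulr0 tr0 eqxx PoszD => ->; rewrite [RHS]addrC addKr.
  by congr Posz; apply: eq_card => y; rewrite !inE.
(* The part of the counts that is constant in [u] is killed by [sum_qchar], so only [u = 1]
   contributes. *)
have E4 : \sum_(u : L) ((#|[set y | tr ((1 - u) * y) == 0]|)%:Z - 1) * qchar u
    = Q ^+ m - Q ^+ (m - 1).
  under eq_bigr => u _ do rewrite cK addrAC mulrDl.
  rewrite big_split /= -mulr_sumr sum_qchar // mulr0 add0r (bigD1 1) //=.
  rewrite eqxx mul1r big1 ?addr0 => [|u /negPf->]; last by rewrite !mul0r.
  by have := @qchar_sqr _ oddL 1 (oner_neq0 L); rewrite expr1n => ->; rewrite mulr1.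
have : (Q - 1) * trace_qsum 1 ^+ 2 = (Q - 1) * Q ^+ (m - 1).
  rewrite -E1 E2 E3 E4 mulrBl mul1r -exprS; congr (_ ^+ _ - _).
  by rewrite subn1 prednK.
by apply: mulfI; have := card_gt1 F; lia.
Qed.

(** Only the square of [trace_qsum 1] is known, hence the undetermined sign [d]; [m] odd makes
    [Q ^+ (m - 1)] a perfect square. *)
Lemma quadric_signP : exists2 d : int, d ^+ 2 = 1 &
  forall a, (#|[set x | tr (x ^+ 2) == a]|)%:Z =
    Q ^+ (m - 1) + d * qchar a * Q ^+ ((m - 1) %/ 2).
Proof.
have : (trace_qsum 1 == Q ^+ ((m - 1) %/ 2)) || (trace_qsum 1 == - Q ^+ ((m - 1) %/ 2)).
  rewrite -eqf_sqr trace_qsum1_sqr -exprM; apply/eqP; congr (_ ^+ _).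
  by move: oddm; lia.
case/orP=> /eqP E; [exists 1 | exists (-1)] => // a;
  rewrite card_quadric_qsum trace_qsumE E; ring.
Qed.

(* Stereographic projection from b: the lines b + t d through b meet the quadric
   tr (x ^ 2) = tr (b ^ 2) in one further point if tr (d ^ 2) and tr (b d) are
   both nonzero, lie on it if both vanish, and meet it only in b otherwise. *)
Lemma stereographic_count b : b != 0 ->
  (Q - 1) * (#|[set x | tr (x ^+ 2) == tr (b ^+ 2)]|)%:Z =
  Q * (#|[set x | (tr (x ^+ 2) == 0) && (tr (b * x) == 0)]|)%:Z
  - (#|[set x | tr (x ^+ 2) == 0]|)%:Z - Q ^+ (m - 1) + Q ^+ m.
Proof.
move=> b0.
pose G d t := tr ((b + iota t * d) ^+ 2) == tr (b ^+ 2).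
have GE d t : t != 0 -> G d t = (2%:R * tr (b * d) + t * tr (d ^+ 2) == 0).
  move=> t0; rewrite /G.
  have -> : (b + iota t * d) ^+ 2 = b ^+ 2 + iota t * (2%:R * (b * d) + iota t * d ^+ 2).
    ring.
  rewrite trD trZ trD trZ -subr_eq0 addrC addKr mulf_eq0 (negPf t0) /=.
  by rewrite -(rmorph_nat iota 2) trZ.
(* The pairs [(t, d)] with [t] nonzero and [G d t] are counted in two ways. For fixed [t], the map
   from [d] to [b + iota t * d] is a bijection of [L]. *)
have E : \sum_(t : F) \sum_(d : L) ((t != 0) && G d t)%:R =
   (Q - 1) * (#|[set x | tr (x ^+ 2) == tr (b ^+ 2)]|)%:Z.
  transitivity (\sum_(t : F) (t != 0)%:R * (#|[set x | tr (x ^+ 2) == tr (b ^+ 2)]|)%:Z).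
    apply: eq_bigr => t _; have [->|t0] := eqVneq t 0; first by rewrite mul0r big1.
    have it0 : iota t != 0 by rewrite fmorph_eq0.
    rewrite mul1r -sum_bool_card; symmetry.
    by rewrite (reindex_inj (addrI b)) (reindex_inj (mulfI it0)).
  rewrite sum_mulb_card; congr (_ * _).
  have -> : [set x : F | x != 0] = [set~ 0] by apply/setP=> x; rewrite !inE.
  by rewrite cardsC1 predn_int // ltnW // card_gt1.
rewrite -E exchange_big /=.
(* The right-hand side also becomes a sum over [d], to be compared term by term with the number of
   [t] for each [d]. *)
have -> : Q ^+ (m - 1) = \sum_(d : L) (tr (b * d) == 0)%:R.
  by rewrite sum_bool_card (card_trace_fibre iota m_gt0 cardL) // PoszX.
have -> : Q ^+ m = \sum_(d : L) 1 by rewrite sumr_const natz cardL PoszX.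
rewrite -!sum_bool_card mulr_sumr -!sumrB -big_split /=; apply: eq_bigr => d _.
under eq_bigr => t _.
  rewrite (_ : (t != 0) && G d t = (t != 0) && (2%:R * tr (b * d) + t * tr (d ^+ 2) == 0)).
    over.
  by case: (eqVneq t 0) => //= t0; rewrite GE.
rewrite sum_bool_card.
have [->|Q0] := eqVneq (tr (d ^+ 2)) 0.
  have [->|B0] := eqVneq (tr (b * d)) 0.
    rewrite -[RHS](_ : (#|[set~ (0 : F)]|)%:Z = _); last first.
      by rewrite cardsC1 predn_int ?(ltnW (card_gt1 F)) //=; ring.
    by congr Posz; apply: eq_card => t; rewrite !inE !mulr0 addr0 eqxx andbT.
  rewrite eq_card0 /= => [|t]; first by ring.
  by rewrite inE mulr0 addr0 mulf_eq0 (negPf (two_neq0 oddF)) (negPf B0) andbF.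
have sol t : (2%:R * tr (b * d) + t * tr (d ^+ 2) == 0) =
    (t == - (2%:R * tr (b * d) / tr (d ^+ 2))).
  by rewrite addrC addr_eq0 -[RHS](inj_eq (mulIf Q0)) mulNr divfK.
have [B0|B0] := eqVneq (tr (b * d)) 0.
  rewrite eq_card0 /= => [|t]; first by ring.
  by rewrite inE sol B0 mulr0 mul0r oppr0 andNb.
rewrite -[RHS](_ : (#|[set - (2%:R * tr (b * d) / tr (d ^+ 2))]|)%:Z = _); last first.
  by rewrite cards1 /=; ring.
congr Posz; apply: eq_card => t; rewrite !inE sol.
have [->|_] := eqVneq t (- _); last by rewrite andbF.
by rewrite oppr_eq0 !mulf_eq0 invr_eq0 (negPf (two_neq0 oddF)) (negPf B0) (negPf Q0).
Qed.

(** [D] is stable under multiplication by [iota c], which carries the section at level 1 to the one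
    at level [c]. *)
Lemma section_scale b c : c != 0 ->
  #|[set x | (tr (x ^+ 2) == 0) && (tr (b * x) == c)]| =
  #|[set x | (tr (x ^+ 2) == 0) && (tr (b * x) == 1)]|.
Proof.
move=> c0; have ic0 : iota c != 0 by rewrite fmorph_eq0.
rewrite -(card_preimset _ (mulfI ic0)); apply: eq_card => x; rewrite !inE.
rewrite exprMn -rmorphXn [b * (_ * _)]mulrCA !trZ mulf_eq0 expf_eq0 (negPf c0) /=.
by rewrite -{2}[c]mulr1 (inj_eq (mulfI c0)).
Qed.

Lemma section_total b c : c != 0 ->
  (#|[set x | (tr (x ^+ 2) == 0) && (tr (b * x) == 0)]|)%:Z +
  (Q - 1) * (#|[set x | (tr (x ^+ 2) == 0) && (tr (b * x) == c)]|)%:Z =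
  (#|[set x | tr (x ^+ 2) == 0]|)%:Z.
Proof.
move=> c0; rewrite (@card_fibres L F (fun x => tr (x ^+ 2) == 0) (fun x => tr (b * x))).
rewrite (bigD1 0) //= PoszD; congr (_ + _).
under eq_bigr => a a0 do rewrite section_scale //.
rewrite sum_nat_const PoszM section_scale //; congr (_ * _).
by rewrite cardC1 predn_int // ltnW // card_gt1.
Qed.

End QuadricCount.

(** * Linear codes *)

Section LinearCodes.

Variables (F : finFieldType) (n : nat).
Implicit Types (C : {set 'rV[F]_n}) (u v : 'rV[F]_n).

(** A linear code equals its span; this connects codes as sets with [code_dim], the dimension of a
    span. *)
Lemma mem_span_code C u : lin_code C -> (u \in <<enum C>>%VS) = (u \in C).
Proof.
case=> C0 CD; apply/idP/idP => [/coord_span->|uC]; last by rewrite memv_span // mem_enum.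
elim/big_ind: _ => // [v w vC wC|i _].
  by rewrite -[v]scale1r CD.
by rewrite -[X in X \in C]addr0 CD // -mem_enum mem_nth // -cardE ltn_ord.
Qed.

Lemma card_lin_code C : lin_code C -> #|C| = (#|F| ^ code_dim C)%N.
Proof.
by move=> linC; rewrite -card_vspace; apply: eq_card => u; rewrite mem_span_code.
Qed.

Lemma mem_dual_code C v :
  reflect (forall u, u \in C -> v *m u^T = 0) (v \in dual_code C).
Proof.
rewrite inE; apply: (iffP forall_inP) => H u /H; last by move->.
by move/eqP.
Qed.

Lemma lin_dual_code C : lin_code (dual_code C).
Proof.
split=> [|a u v /mem_dual_code uC /mem_dual_code vC]; apply/mem_dual_code => w wC.
  by rewrite mul0mx.
by rewrite mulmxDl -scalemxAl uC // vC // scaler0 addr0.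
Qed.

(** With a basis of the span as the rows of [A], the dual is the kernel of the transpose of [A], and
    [A] has rank [code_dim C]. *)
Lemma card_dual_code C : #|dual_code C| = (#|F| ^ (n - code_dim C))%N.
Proof.
pose X := vbasis <<enum C>>%VS.
pose A : 'M[F]_(code_dim C, n) := \matrix_(i < code_dim C) X`_i.
have mulA (a : 'rV_(code_dim C)) : a *m A = \sum_i a 0 i *: X`_i.
  by rewrite mulmx_sum_row; apply: eq_bigr => i _; rewrite rowK.
have freeA : row_free A.
  apply: inj_row_free => u; rewrite mulA => u0; apply/rowP => i; rewrite mxE.
  have /freeP fX : free X by apply: basis_free (vbasisP _).
  exact: (fX (fun i => u 0 i) u0 i).
rewrite -[X in (n - X)%N](eqnP freeA) -mxrank_tr -mxrank_ker -card_rowg.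
apply: eq_card => v; rewrite mem_rowg; apply/mem_dual_code/sub_kermxP => [vC|vA u uC].
  apply/rowP => i; rewrite mxE.
  suff : forall w, w \in <<enum C>>%VS -> v *m w^T = 0.
    move=> H; have : v *m (X`_i)^T = 0.
      by apply/H/vbasis_mem/mem_nth; rewrite size_tuple.
    move/matrixP/(_ 0 0); rewrite !mxE => E; rewrite -[RHS]E.
    by apply: eq_bigr => j _; rewrite !mxE.
  move=> w /coord_span->; rewrite linear_sum /= mulmx_sumr big1 // => j _.
  by rewrite linearZ /= -scalemxAr vC ?scaler0 // -mem_enum mem_nth // -cardE ltn_ord.
have uE : u = (\row_i coord X i u) *m A.
  have uS : u \in <<enum C>>%VS by rewrite memv_span // mem_enum.
  rewrite mulA [LHS](coord_vbasis uS).
  by apply: eq_bigr => i _; rewrite mxE.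
by rewrite uE trmx_mul mulmxA vA mul0mx.
Qed.

Lemma code_dim_card C d : lin_code C -> #|C| = (#|F| ^ d)%N -> code_dim C = d.
Proof.
by move=> linC; rewrite card_lin_code // => /eqP; rewrite eqn_exp2l ?card_gt1 // => /eqP.
Qed.

Lemma wt_eq0 u : (wt u == 0%N) = (u == 0).
Proof.
rewrite /wt cards_eq0; apply/eqP/eqP => [u0|->].
  apply/rowP => i; apply/eqP; have := in_set0 i.
  by rewrite -u0 inE mxE => /negbFE.
by apply/setP => i; rewrite !inE mxE eqxx.
Qed.

End LinearCodes.

Lemma card_enum_val (T : finType) (A : {set T}) (P : pred T) :
  #|[set i : 'I_#|A| | P (enum_val i)]| = #|[set x in A | P x]|.
Proof.
rewrite -(card_imset _ (@enum_val_inj _ A)); apply: eq_card => x.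
rewrite inE; apply/imsetP/andP => [[i + ->]|[xA Px]].
  by rewrite inE enum_valP.
by exists (enum_rank_in xA x); rewrite ?inE enum_rankK_in.
Qed.

(** * The code of the quadric *)

(** [qchar] is 0 once and takes each of 1 and -1 on half of the nonzero elements; the factor 2
    avoids division. *)
Lemma sum_qchar_fun (K : finFieldType) (g : int -> int) : odd #|K| ->
  2 * (\sum_(a : K) g (qchar a)) = 2 * g 0 + (#|K|%:Z - 1) * (g 1 + g (-1)).
Proof.
move=> oddK.
have -> : \sum_(a : K) g (qchar a) = \sum_(a : K) ((a == 0)%:R * g 0 +
    ((qchar a == 1)%:R * g 1 + (qchar a == -1)%:R * g (-1))).
  apply: eq_bigr => a _; have [->|a0] := eqVneq a 0.
    by rewrite qchar0 !mul0r !addr0 mul1r.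
  by case/orP: (qchar_val a0) => /eqP->; rewrite ?eqxx ?mul0r ?mul1r ?add0r ?addr0.
rewrite !big_split /= !sum_mulb_card.
have -> : [set x : K | x == 0] = [set 0] by apply/setP=> x; rewrite !inE.
have c1 := @card_qchar K oddK 1%R erefl; have c2 := @card_qchar K oddK (-1)%R erefl.
by rewrite cards1 mul1r !mulrDr !mulrA c1 c2.
Qed.

(* Throughout, m = 2 k + 3, R = q ^ ((m - 3) / 2) and K = q ^ ((m - 1) / 2), so
   that the weights become R times an integer linear in Q K, K, Q and 1. *)
Section CardinalBounds.

Variables (F : finFieldType) (k : nat).
Hypothesis oddF : odd #|F|.
Local Notation Q := (#|F|%:Z).
Local Notation R := (#|F|%:Z ^+ k).
Local Notation K := (#|F|%:Z ^+ k.+1).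

Lemma card_bounds : [/\ 3 <= Q, 1 <= R & K = Q * R].
Proof.
have R0 : 1 <= R by rewrite -PoszX lez_nat expn_gt0 ltnW // card_gt1.
by split; rewrite ?exprS //; have := card_gt1 F; move: oddF; lia.
Qed.

Lemma card_leK : Q <= K.
Proof. by have [Q3 R1 ->] := card_bounds; rewrite ler_peMr //; lia. Qed.

(** With [(Q - 1) * K] treated as a single unknown, these bounds let [lia] tell the weights
    apart. *)
Lemma wt_bounds : [/\ 3 <= Q, Q <= K & 2 * K <= (Q - 1) * K].
Proof.
have [Q3 _ _] := card_bounds; have QK := card_leK; split=> //.
by move: (Q) (K) Q3 QK => ? ?; nia.
Qed.

End CardinalBounds.

Lemma expr_sub1E (a : int) (m k : nat) : m = (k * 2 + 3)%N ->
  a ^+ (m - 1) = a ^+ k.+1 * a ^+ k.+1.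
Proof. by move=> ->; rewrite -exprD; congr (_ ^+ _); lia. Qed.

Lemma expr_kE (a : int) (m k : nat) : m = (k * 2 + 3)%N ->
  a ^+ m = a * (a ^+ k.+1 * a ^+ k.+1).
Proof. by move=> ->; rewrite -exprD -exprS; congr (_ ^+ _); lia. Qed.

Section DefiningSetCode.

Variables (F L : finFieldType) (iota : {rmorphism F -> L}) (m k : nat).
Hypotheses (cardL : #|L| = (#|F| ^ m)%N) (oddF : odd #|F|) (mE : m = (k * 2 + 3)%N).
Local Notation q := #|F|.
Local Notation Q := (#|F|%:Z).
Local Notation R := (#|F|%:Z ^+ k).
Local Notation K := (#|F|%:Z ^+ k.+1).
Local Notation tr := (trace iota m).
Local Notation D := (Dset iota m).
Local Notation C := (CDbar iota m).
Local Notation cw := (cwD iota m).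
Implicit Types (x y b : L) (a c t : F).

Let oddm : odd m. Proof. by rewrite mE; lia. Qed.
Let m_gt0 : (0 < m)%N. Proof. exact: odd_gt0. Qed.
Let oddL : odd #|L|. Proof. by rewrite cardL oddX oddF orbT. Qed.
Let trD := traceD iota m_gt0 cardL.
Let trZ := traceZ iota m_gt0 cardL.
Let tr0 := trace0 iota m_gt0 cardL.
Let trN := traceN iota m_gt0 cardL.

Variable d : int.
Hypothesis d2 : d ^+ 2 = 1.
Hypothesis card_quadric : forall a,
  (#|[set x | tr (x ^+ 2) == a]|)%:Z = K * K + d * qchar a * K.

(** Absorbing the sign [d] into the type of [b] makes the formulas for sections, weights and
    frequencies free of [d]. *)
Definition quad_type b : int := d * qchar (tr (b ^+ 2)).
Local Notation E := quad_type.

Lemma quad_type0 : E 0 = 0.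
Proof. by rewrite /E expr0n tr0 qchar0 mulr0. Qed.

Lemma sign_val : (d == 1) || (d == -1).
Proof. by rewrite -eqf_sqr d2 expr1n. Qed.

Lemma quad_type_val b : [\/ E b = 0, E b = 1 | E b = -1].
Proof.
rewrite /E; have [->|a0] := eqVneq (tr (b ^+ 2)) 0.
  by constructor 1; rewrite qchar0 mulr0.
case/orP: (qchar_val a0) => /eqP->; case/orP: sign_val => /eqP->;
  rewrite ?mulr1 ?mulrN1 ?opprK; by [constructor 2 | constructor 3].
Qed.

Lemma card_Dset : #|D|%:Z = K * K.
Proof. by rewrite card_quadric qchar0 mulr0 mul0r addr0. Qed.

(** * Hyperplane sections of the quadric and weights of codewords *)

Local Notation M b c := (#|[set x | (tr (x ^+ 2) == 0) && (tr (b * x) == c)]|%:Z).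

(** This solves [stereographic_count] for its only unknown, since [card_quadric] supplies both
    quadric sizes. *)
Lemma section0 b : b != 0 -> M b 0 = R * K + (Q - 1) * E b * R.
Proof.
move=> b0; have := stereographic_count iota cardL oddF oddm b0.
rewrite !card_quadric qchar0 (expr_sub1E _ mE) (expr_kE _ mE) -/(E b).
have [Q3 R1 ->] := card_bounds k oddF; move: (M b 0) (E b) => x e H.
have Q0 : Q != 0 by lia.
apply: (mulfI Q0); move: H; move: (Q) (R) => q r H.
apply: (addrI (q * (q * r * (q * r)) - 2 * (q * r * (q * r)))).
by transitivity ((q - 1) * (q * r * (q * r) + e * (q * r))); [rewrite H|]; ring.
Qed.

Lemma sectionN0 b c : b != 0 -> c != 0 -> M b c = R * K - E b * R.
Proof.
move=> b0 c0; have := section_total iota cardL oddm b c0.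
rewrite (section0 b0) card_quadric qchar0.
have [Q3 R1 ->] := card_bounds k oddF; move: (M b c) (E b) => x e H.
have Q0 : Q - 1 != 0 by lia.
apply: (mulfI Q0); move: H; move: (Q) (R) => q r H.
apply: (addrI (r * (q * r) + (q - 1) * e * r)); rewrite H; ring.
Qed.

Lemma wt_cwD b c : (wt (cw b c))%:Z = K * K - M b (- c).
Proof.
rewrite -card_Dset /wt.
have -> : [set i | cw b c 0 i != 0] = [set i : 'I_#|D| | tr (b * enum_val i) + c != 0].
  by apply/setP=> i; rewrite !inE mxE.
rewrite (@card_enum_val _ D (fun x => tr (b * x) + c != 0)).
have -> : [set x | (tr (x ^+ 2) == 0) && (tr (b * x) == - c)] =
    D :&: [set x | tr (b * x) + c == 0] by apply/setP=> x; rewrite !inE addr_eq0.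
have := cardsID [set x | tr (b * x) + c == 0] D => /(congr1 Posz) <-.
rewrite PoszD [RHS]addrC addKr; congr Posz; apply: eq_card => x.
by rewrite !inE andbC.
Qed.

Lemma wt_cw00 : wt (cw 0 0) = 0%N.
Proof.
apply/eqP; rewrite wt_eq0; apply/eqP/rowP => i.
by rewrite !mxE mul0r tr0 addr0.
Qed.

Lemma wt_cw0 c : c != 0 -> (wt (cw 0 c))%:Z = R * (Q * K).
Proof.
move=> c0; rewrite wt_cwD eq_card0 ?subr0 => [|x]; last first.
  by rewrite inE mul0r tr0 [0 == - c]eq_sym oppr_eq0 (negPf c0) andbF.
by have [_ _ {1}->] := card_bounds k oddF; ring.
Qed.

Lemma wt_cwb0 b : b != 0 -> (wt (cw b 0))%:Z = R * ((Q - 1) * K - (Q - 1) * E b).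
Proof.
move=> b0; rewrite wt_cwD oppr0 section0 //.
by have [_ _ ->] := card_bounds k oddF; ring.
Qed.

Lemma wt_cwb b c : b != 0 -> c != 0 -> (wt (cw b c))%:Z = R * ((Q - 1) * K + E b).
Proof.
move=> b0 c0; rewrite wt_cwD sectionN0 ?oppr_eq0 //.
by have [_ _ ->] := card_bounds k oddF; ring.
Qed.

Lemma cwD_lin a b c b' c' : a *: cw b c + cw b' c' = cw (iota a * b + b') (a * c + c').
Proof.
by apply/rowP => i; rewrite !mxE mulrDl trD -mulrA trZ mulrDr addrACA.
Qed.

Lemma CDbarP u : reflect (exists b c, u = cw b c) (u \in C).
Proof.
apply: (iffP imset2P) => [[b c _ _ ->]|[b [c ->]]]; first by exists b, c.
by exists b c.
Qed.

Lemma lin_CDbar : lin_code C.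
Proof.
split=> [|a u v /CDbarP[b [c ->]] /CDbarP[b' [c' ->]]].
  by apply/CDbarP; exists 0, 0; apply/esym/eqP; rewrite -wt_eq0 wt_cw00.
by rewrite cwD_lin; apply/CDbarP; do 2!eexists.
Qed.

(** Every pair [(b, c)] other than [(0, 0)] has positive weight by the formulas above; linearity
    then makes the parametrisation injective. *)
Lemma cwD_eq0 b c : (cw b c == 0) = (b == 0) && (c == 0).
Proof.
rewrite -wt_eq0; have [Q3 R1 _] := card_bounds k oddF; have QK := card_leK k oddF.
have pos n X : 0 < X -> n%:Z = R * X -> (n == 0)%N = false.
  move=> X0 nE; apply/eqP => n0; have : 0 < R * X by rewrite mulr_gt0 //; lia.
  by rewrite -nE n0.
have [->|b0] := eqVneq b 0; have [->|c0] := eqVneq c 0; rewrite /= ?wt_cw00 //.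
- by apply: pos (wt_cw0 c0); move: (Q) (K) Q3 QK => ? ?; nia.
- apply: pos (wt_cwb0 b0).
  by case: (quad_type_val b) => ->; move: (Q) (K) Q3 QK => ? ?; nia.
- apply: pos (wt_cwb b0 c0).
  by case: (quad_type_val b) => ->; move: (Q) (K) Q3 QK => ? ?; nia.
Qed.

Lemma cwD_inj b c b' c' : cw b c = cw b' c' -> b = b' /\ c = c'.
Proof.
move=> E; have /eqP := cwD_lin (-1) b c b' c'.
rewrite E scaleN1r addNr eq_sym cwD_eq0 rmorphN1 !mulN1r ![- _ + _]addrC !subr_eq0.
by case/andP=> /eqP-> /eqP->.
Qed.

(** * Frequencies of the weights *)

Lemma card_CDbar_filter (P : pred 'rV[F]_#|D|) :
  (#|[set u in C | P u]|)%:Z = \sum_b \sum_c (P (cw b c))%:R.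
Proof.
rewrite pair_big /= sum_bool_card; congr Posz.
have inj : injective (fun bc : L * F => cw bc.1 bc.2).
  by case=> b c [b' c'] /= /cwD_inj[-> ->].
rewrite -(card_imset _ inj); apply: eq_card => u; rewrite !inE.
apply/andP/imsetP => [[/CDbarP[b [c ->]] Pbc]|[[b c]]].
  by exists (b, c); rewrite ?inE.
by rewrite inE /= => Pbc ->; split=> //; apply/CDbarP; exists b, c.
Qed.

Lemma card_CDbar : #|C| = (q ^ (m + 1))%N.
Proof.
have := card_CDbar_filter predT.
have -> : [set u in C | predT u] = C by apply/setP=> u; rewrite inE andbT.
under eq_bigr do rewrite sumr_const.
rewrite sumr_const => /eqP.
by rewrite -mulrnA natz eqz_nat cardL expnD expn1 mulnC => /eqP.
Qed.

(** The [b] with [tr (b ^+ 2) = a] all have type [e = d * qchar a], and there are [K * K + e * K] of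
    them; as [a] runs over the nonzero elements both signs of [e] are equally frequent, so [d] drops
    out. *)
Lemma sum_quad_type (f : int -> int) : 2 * \sum_(b | b != 0) f (E b) =
  2 * (K * K - 1) * f 0 + (Q - 1) * (K * K + K) * f 1 + (Q - 1) * (K * K - K) * f (-1).
Proof.
have H : 2 * \sum_b f (E b) =
    2 * (K * K) * f 0 + (Q - 1) * (K * K + K) * f 1 + (Q - 1) * (K * K - K) * f (-1).
  rewrite (partition_big (fun b => tr (b ^+ 2)) predT) //=.
  under eq_bigr => a _.
    rewrite (eq_bigr (fun _ => f (d * qchar a))) => [|b /eqP<-//].
    rewrite sumr_const -mulr_natl natz -cardsE card_quadric; over.
  rewrite /= (sum_qchar_fun (fun e => (K * K + d * e * K) * f (d * e))) //.
  by case/orP: sign_val => /eqP->; rewrite ?mulr0 ?mulr1 ?mul1r ?mulrNN ?mulN1r ?opprK; ring.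
(* The element [b = 0] has type 0 and accounts for one term [f 0]. *)
rewrite (bigD1 0) //= quad_type0 mulrDr in H.
by apply: (addrI (2 * f 0)); rewrite H; ring.
Qed.

(** The indicators postpone all comparisons of weights until [X] is specialised; each row of the
    table is then an instance. *)
Lemma freq_CDbar (X : int) : 2 * (freqz C (R * X))%:Z =
  2 * (0 == X)%:R + 2 * (Q - 1) * (Q * K == X)%:R
  + 2 * (K * K - 1) * Q * ((Q - 1) * K == X)%:R
  + (Q - 1) * (K * K + K) * (((Q - 1) * K - (Q - 1) == X)%:R
                             + (Q - 1) * ((Q - 1) * K + 1 == X)%:R)
  + (Q - 1) * (K * K - K) * (((Q - 1) * K + (Q - 1) == X)%:R
                             + (Q - 1) * ((Q - 1) * K - 1 == X)%:R).
Proof.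
have [Q3 R1 _] := card_bounds k oddF; have R0 : R != 0 by lia.
rewrite /freqz card_CDbar_filter (bigD1 0) //= mulrDr.
have sumF (z : int) : \sum_(c : F | c != 0) z = (Q - 1) * z.
  rewrite sumr_const -mulr_natl natz (eq_card (B := predC1 (0 : F))) //.
  by rewrite cardC1 predn_int // ltnW // card_gt1.
have -> : \sum_c ((wt (cw 0 c))%:Z == R * X)%:R = (0 == X)%:R + (Q - 1) * (Q * K == X)%:R :> int.
  rewrite (bigD1 0) //= wt_cw00 -[X in X == R * _](mulr0 R) (inj_eq (mulfI R0)); congr (_ + _).
  under eq_bigr => c c0 do rewrite wt_cw0 // (inj_eq (mulfI R0)).
  by rewrite sumF.
under eq_bigr => b b0.
  rewrite (bigD1 0) //= wt_cwb0 // (inj_eq (mulfI R0)).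
  under eq_bigr => c c0 do rewrite wt_cwb // (inj_eq (mulfI R0)).
  rewrite sumF.
  over.
rewrite (sum_quad_type (fun e => ((Q - 1) * K - (Q - 1) * e == X)%:R +
                                 (Q - 1) * ((Q - 1) * K + e == X)%:R)).
rewrite /= !mulr0 subr0 mulr1 mulrN1 opprK; ring.
Qed.

Lemma wt_CDbar u : u \in C -> exists2 X, (wt u)%:Z = R * X &
  X \in [:: 0; Q * K; (Q - 1) * K; (Q - 1) * K + 1; (Q - 1) * K - 1;
            (Q - 1) * K - (Q - 1); (Q - 1) * K + (Q - 1)].
Proof.
move=> /CDbarP[b [c ->]]; have [->|b0] := eqVneq b 0; have [->|c0] := eqVneq c 0.
- by exists 0; rewrite ?wt_cw00 ?mulr0 // !inE eqxx.
- by exists (Q * K); rewrite ?wt_cw0 // !inE eqxx ?orbT.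
- exists ((Q - 1) * K - (Q - 1) * E b); first exact: wt_cwb0.
  by case: (quad_type_val b) => ->; rewrite ?mulr0 ?mulr1 ?mulrN1 ?opprK ?subr0 !inE eqxx ?orbT.
- exists ((Q - 1) * K + E b); first exact: wt_cwb.
  by case: (quad_type_val b) => ->; rewrite ?addr0 !inE eqxx ?orbT.
Qed.

Lemma wt_CDbar_ge u : u \in C -> u != 0 -> R * ((Q - 1) * K - (Q - 1)) <= (wt u)%:Z.
Proof.
move=> /wt_CDbar[X uX X_in]; rewrite -wt_eq0 => u0.
have [_ R1 _] := card_bounds k oddF; have [Q3 QK ZK] := wt_bounds k oddF.
have X0 : X != 0 by apply: contraNneq u0 => X0; rewrite X0 mulr0 in uX; case: uX => ->.
rewrite uX ler_wpM2l //; first by lia.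
(* Writing [Q * K] through [(Q - 1) * K] makes every candidate weight linear in [Z], [K] and [Q]. *)
have QKE : Q * K = (Q - 1) * K + K by ring.
rewrite QKE in X_in; move: X_in X0; rewrite !inE.
by move: ((Q - 1) * K) ZK => Z ZK; do ![case/orP]; move/eqP->; lia.
Qed.

(** Evaluates the indicators of [freq_CDbar]: at a given [X], each comparison of weights is linear
    arithmetic. *)
Ltac decide_int_eqs := repeat match goal with
  |- context [nat_of_bool (?a == ?b)] =>
    first [rewrite (_ : (a == b) = false); last by lia
          |rewrite (_ : (a == b) = true); last by lia] end;
  rewrite /= ?mulr0n ?mulr1n !(mulr0, addr0, add0r, mulr1).

Lemma freq_zero : (freqz C 0)%:Z = 1.
Proof.
have := freq_CDbar 0; rewrite mulr0; have [Q3 QK ZK] := wt_bounds k oddF.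
move: (freqz _ _) => f.
have -> : Q * K = (Q - 1) * K + K by ring.
move: ((Q - 1) * K) ZK => Z ZK.
by decide_int_eqs => H; lia.
Qed.

Lemma freq_top : (freqz C (R * (Q * K)))%:Z = Q - 1.
Proof.
have := freq_CDbar (Q * K); have [Q3 QK ZK] := wt_bounds k oddF.
move: (freqz _ _) => f; have -> : Q * K = (Q - 1) * K + K by ring.
move: ((Q - 1) * K) ZK => Z ZK.
by decide_int_eqs => H; lia.
Qed.

Lemma freq_mid : (freqz C (R * ((Q - 1) * K)))%:Z = Q * (K * K - 1).
Proof.
have := freq_CDbar ((Q - 1) * K); have [Q3 QK ZK] := wt_bounds k oddF.
move: (freqz _ _) => f; have -> : Q * K = (Q - 1) * K + K by ring.
move: ((Q - 1) * K) ZK => Z ZK.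
by decide_int_eqs => H; lia.
Qed.

Lemma freq_plus1 (s : int) : (s == 1) || (s == -1) ->
  2 * (freqz C (R * ((Q - 1) * K + s)))%:Z = (Q - 1) ^+ 2 * (K * K + s * K).
Proof.
move=> s1; have := freq_CDbar ((Q - 1) * K + s); have [Q3 QK ZK] := wt_bounds k oddF.
move: (freqz _ _) => f; have -> : Q * K = (Q - 1) * K + K by ring.
move: ((Q - 1) * K) ZK => Z ZK.
by case/orP: s1 => /eqP->; decide_int_eqs => ->; ring.
Qed.

Lemma freq_minusQ (s : int) : (s == 1) || (s == -1) ->
  2 * (freqz C (R * ((Q - 1) * K - s * (Q - 1))))%:Z = (Q - 1) * (K * K + s * K).
Proof.
move=> s1; have := freq_CDbar ((Q - 1) * K - s * (Q - 1)); have [Q3 QK ZK] := wt_bounds k oddF.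
move: (freqz _ _) => f; have -> : Q * K = (Q - 1) * K + K by ring.
move: ((Q - 1) * K) ZK => Z ZK.
by case/orP: s1 => /eqP->; decide_int_eqs => ->; ring.
Qed.

(** * Self-orthogonality *)

Lemma section_natr0 b a : (0 < k)%N ->
  #|[set x | (tr (x ^+ 2) == 0) && (tr (b * x) == a)]|%:R = 0 :> F.
Proof.
(* Every count below is a multiple of [R = Q ^+ k], which is 0 in [F] because [k] is positive. *)
move=> k_gt0; have R0 (Y : int) n : n%:Z = R * Y -> n%:R = 0 :> F.
  move=> nE; rewrite -[n%:R]/(n%:Z%:~R) nE rmorphM /= -PoszX -pmulrn natrX.
  by rewrite natr_card0 expr0n gtn_eqF // mul0r.
have [->|b0] := eqVneq b 0.
  have [->|a0] := eqVneq a 0.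
    have [_ _ KE] := card_bounds k oddF.
    apply: (R0 (Q * K)); rewrite mulrA [R * Q]mulrC -KE -card_Dset; congr Posz.
    by apply: eq_card => x; rewrite !inE mul0r tr0 eqxx andbT.
  rewrite eq_card0 // => x.
  by rewrite inE mul0r tr0 [0 == a]eq_sym (negPf a0) andbF.
have [->|a0] := eqVneq a 0.
  by apply: (R0 (K + (Q - 1) * E b)); rewrite section0 //; ring.
by apply: (R0 (K - E b)); rewrite sectionN0 //; ring.
Qed.

(** Grouping by [a = tr (b * x)], each [g a] is multiplied by a count that is 0 in [F]. *)
Lemma sum_Dset0 (g : F -> F) b : (0 < k)%N -> \sum_(x in D) g (tr (b * x)) = 0.
Proof.
move=> k_gt0; rewrite (partition_big (fun x => tr (b * x)) predT) //=.
apply: big1 => a _; rewrite (eq_bigr (fun _ => g a)) => [|x /andP[_ /eqP->]//].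
rewrite sumr_const -mulr_natl -[RHS](mul0r (g a)); congr (_ * _).
rewrite -[RHS](section_natr0 b a k_gt0); congr (_ *+ _); apply: eq_card => x.
by rewrite unfold_in !inE.
Qed.

(** Polarisation: [dot u u = 0] on [C] by [sum_Dset0] applied to the square of [a + c], so expanding
    [dot (u + v) (u + v)] gives [2 * dot u v = 0], and 2 is nonzero in [F]. *)
Lemma self_orthogonal_CDbar : (0 < k)%N -> self_orthogonal C.
Proof.
move=> k_gt0.
pose dot (u v : 'rV[F]_#|D|) : F := \sum_i u 0 i * v 0 i.
have sq0 u : u \in C -> dot u u = 0.
  move=> /CDbarP[b [c ->]]; rewrite -[RHS](sum_Dset0 (fun a => (a + c) * (a + c)) b k_gt0).
  by rewrite big_enum_val; apply: eq_bigr => i _; rewrite !mxE.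
apply/subsetP=> u uC; apply/mem_dual_code => v vC.
have uvC : u + v \in C by rewrite -[u]scale1r lin_CDbar.2.
have : 2%:R * dot u v = 0.
  rewrite -(sq0 _ uvC) -[LHS]addr0 -{1}(sq0 _ uC) -[LHS]addr0 -{1}(sq0 _ vC).
  rewrite /dot mulr_sumr -!big_split; apply: eq_bigr => i _ /=.
  by rewrite !mxE; ring.
move/eqP; rewrite mulf_eq0 (negPf (two_neq0 oddF)) /= => /eqP uv0.
apply/matrixP=> i j; rewrite !ord1 !mxE -[RHS]uv0.
by apply: eq_bigr => l _; rewrite !mxE.
Qed.

(** * The dual code and its minimum distance *)

Lemma dual_CDbar_sums v : v \in dual_code C ->
  \sum_i v 0 i = 0 /\ \sum_i iota (v 0 i) * enum_val i = 0.
Proof.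
move=> /mem_dual_code vC.
have S b c : \sum_i v 0 i * (tr (b * enum_val i) + c) = 0.
  have /vC/matrixP/(_ 0 0) : cw b c \in C by apply/CDbarP; exists b, c.
  by rewrite !mxE => E; rewrite -[RHS]E; apply: eq_bigr => i _; rewrite !mxE.
split.
  by rewrite -[RHS](S 0 1); apply: eq_bigr => i _; rewrite mul0r tr0 add0r mulr1.
(* If [w] were nonzero, some [b] would give [tr (w * b) = 1], yet orthogonality to [cw b 0] says
   that this trace is 0. *)
apply: contraTeq isT => w0; set w := \sum_i _ in w0.
have [b bE] := trace_mul_onto iota m_gt0 cardL 1 w0.
suff : tr (w * b) = 0 by rewrite bE => /eqP; rewrite oner_eq0.
rewrite -[RHS](S b 0) /w mulr_suml (big_morph _ trD tr0).
by apply: eq_bigr => i _; rewrite addr0 -mulrA trZ [b * _]mulrC.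
Qed.

(** Entries summing to 0 exclude weight 1; on a support [{i, j}] they force [v 0 i = - v 0 j], and
    the second relation then makes two distinct points of [D] coincide. *)
Lemma dual_wt_ge3 v : v \in dual_code C -> v != 0 -> (3 <= wt v)%N.
Proof.
move=> /dual_CDbar_sums[S1 S2]; rewrite -wt_eq0 -lt0n => /card_gt0P[i].
rewrite inE => vi.
have [j ji vj] : exists2 j, j != i & v 0 j != 0.
  apply/exists_inP; apply: contraT; rewrite negb_exists => /forallP v0.
  have := S1; rewrite (bigD1 i) //= big1 ?addr0 => [/eqP|l li]; first by rewrite (negPf vi).
  by have := v0 l; rewrite li negbK => /eqP.
have two : #|[set i; j]| = 2%N by rewrite cards2 eq_sym ji.
have sub : [set i; j] \subset [set l | v 0 l != 0].
  by apply/subsetP=> l; rewrite !inE => /orP[]/eqP->.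
rewrite ltnNge; apply/negP => wt2.
have supp : [set i; j] = [set l | v 0 l != 0] by apply/eqP; rewrite eqEcard sub two.
have out l : (l != i) && (l != j) -> v 0 l = 0.
  rewrite -negb_or => lij; apply/eqP/negPn; apply: contra lij => vl.
  have : l \in [set i; j] by rewrite supp inE.
  by rewrite !inE.
move: S1 S2; rewrite (bigD1 i) //= (bigD1 j) //= big1 // addr0 => /eqP.
rewrite addr_eq0 => /eqP vij.
rewrite (bigD1 i) //= (bigD1 j) //= big1 => [|l /out->]; last by rewrite rmorph0 mul0r.
rewrite addr0 vij rmorphN mulNr addrC => /eqP; rewrite subr_eq0.
have ivj : iota (v 0 j) != 0 by rewrite fmorph_eq0.
by rewrite (inj_eq (mulfI ivj)) (inj_eq enum_val_inj) (negPf ji).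
Qed.

(* The three collinear points x, 0, -x of D give a dual word of weight 3. *)
Lemma dual_wt3 : exists2 v, v \in dual_code C & wt v = 3%N.
Proof.
have [Q3 _ _] := card_bounds k oddF; have QK := card_leK k oddF.
have inD x : (x \in D) = (tr (x ^+ 2) == 0) by rewrite inE.
have D0 : 0 \in D by rewrite inD expr0n tr0.
have /card_gt0P[x] : (0 < #|D :\ 0%R|)%N.
  have KK : 1 < K * K by move: (Q) (K) Q3 QK => ? ?; nia.
  have := cardsD1 0 D; rewrite D0 => /(congr1 Posz); rewrite card_Dset.
  by rewrite lt0n => KD; apply: contraTneq KK => D1; rewrite KD D1.
rewrite !inE => /andP[x0]; rewrite -inD => Dx.
have DNx : - x \in D by rewrite inD sqrrN -inD.
have rk y (yD : y \in D) : {i : 'I_#|D| | enum_val i = y}.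
  by exists (enum_rank_in yD y); rewrite enum_rankK_in.
have [i0 e0] := rk _ D0; have [i1 e1] := rk _ Dx; have [i2 e2] := rk _ DNx.
have n12 : i1 != i2 by rewrite -(inj_eq enum_val_inj) e1 e2 eq_sym (oppf_eq oddL).
have n10 : i1 != i0 by rewrite -(inj_eq enum_val_inj) e1 e0.
have n20 : i2 != i0 by rewrite -(inj_eq enum_val_inj) e2 e0 oppr_eq0.
(* The coefficients 1, 1, -2 at [x], [- x], 0 cancel both the constant and the linear part of every
   codeword. *)
exists (delta_mx 0 i1 + delta_mx 0 i2 - 2%:R *: delta_mx 0 i0).
  apply/mem_dual_code => u /CDbarP[b [c ->]].
  rewrite mulmxDl mulNmx mulmxDl -scalemxAl -!rowE; apply/rowP => j.
  by rewrite !mxE e0 e1 e2 mulr0 mulrN tr0 trN; ring.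
rewrite /wt -(_ : #|[set i1; i2; i0]| = 3%N); last first.
  by rewrite setUC cardsU1 cards2 !inE n12 negb_or ![i0 == _]eq_sym n10 n20.
apply: eq_card => i; rewrite !inE !mxE !eqxx /=.
have [->|_] := eqVneq i i1; first by rewrite (negPf n12) (negPf n10) mulr0 subr0 addr0 oner_eq0.
have [->|_] := eqVneq i i2; first by rewrite (negPf n20) mulr0 subr0 add0r oner_eq0.
have [_|_] := eqVneq i i0; first by rewrite mulr1 !add0r oppr_eq0 two_neq0.
by rewrite mulr0 addr0 subr0 eqxx.
Qed.

End DefiningSetCode.

(** * The sphere-packing bound *)

Lemma dual_sphere_packing (q m : nat) : (2 < q)%N -> (2 < m)%N ->
  sphere_packing_rules_out q (q ^ (m - 1)) (q ^ (m - 1) - m - 1) 5.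
Proof.
move=> q3 m3; set n := (q ^ (m - 1))%N.
(* This makes the truncated subtraction [n - m - 1] an exact one. *)
have mn : (m + 1 <= n)%N.
  have : (3 ^ (m - 1) <= n)%N by rewrite leq_exp2r //; lia.
  apply: leq_trans; case: m m3 {n} => [|[|[|j]]] // _; rewrite addn1 subn1 /=.
  by elim: j => // j IH; rewrite expnS; lia.
(* Distance 5 is two above the distance 3 of the dual code and gives balls of radius 2. *)
rewrite /sphere_packing_rules_out -[((5 - 1) %/ 2)%N]/2%N.
rewrite !big_ord_recr big_ord0 /= add0n bin0 bin1 expn0 expn1 muln1.
have nq : (q ^ 2 <= n)%N by rewrite leq_exp2l; lia.
(* As [n = q ^ (m - 1)], the redundancy [m + 1] contributes [q ^ (m + 1) = q ^ 2 * n]; it remains to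
   see that a ball of radius 2 has more than [q ^ 2 * n] words. *)
have -> : (q ^ n = q ^ (n - m - 1) * (q ^ 2 * n))%N.
  by rewrite {3}/n -!expnD; congr (_ ^ _)%N; lia.
rewrite ltn_pmul2l ?expn_gt0 ?(ltnW (ltnW q3)) //.
have b2 : ('C(n, 2) * 2 = n * n.-1)%N.
  rewrite bin2 muln2 -[RHS]odd_double_half oddM.
  by case: (n) nq => [|j] //= _; rewrite andNb.
have q1 : (4 <= (q - 1) ^ 2)%N by rewrite (@leq_exp2r 2 _ 2) //; lia.
move: nq b2 q1; rewrite !expnS !expn0 !muln1.
move: ('C(n, 2)) (q - 1)%N => B r nq b2 q1.
(* The quadratic term suffices: four times [B] is [2 n (n - 1)], while [q ^ 2 n <= n ^ 2] and
   [9 n <= n ^ 2]. *)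
have : (B * 4 <= B * (r * r))%N by rewrite leq_mul2l q1 orbT.
have : (q * q * n <= n * n)%N by rewrite leq_mul2r nq orbT.
have : (9 * n <= n * n)%N by rewrite leq_mul2r; apply/orP; right; nia.
have : (n * n.-1 = n * n - n)%N by rewrite -subn1 mulnBr muln1.
by move: (n * n)%N (B * (r * r))%N (q * q * n)%N b2 => N T U b2; lia.
Qed.

Theorem theorem3p18 (p e m q : nat) (F L : finFieldType)
  (iota : {rmorphism F -> L})
  (hp : prime p) (hpodd : odd p) (he : (0 < e)%N) (hq : q = (p ^ e)%N)
  (hF : #|F| = q) (hL : #|L| = (q ^ m)%N) (hm : (3 <= m)%N) (hmodd : odd m) :
  let l := (e * (p - 1) * (m + 3) %/ 4)%N in
  let C := CDbar iota m in
  let s := (-1) ^+ l : int in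
  let Q := q%:Z in
  let w0 := (Q - 1) * Q ^+ (m - 2) in
  #|Dset iota m| = (q ^ (m - 1))%N /\
  is_nkd C (m + 1) ((q - 1) * q ^ ((m - 3) %/ 2) * (q ^ ((m - 1) %/ 2) - 1))%N /\
  (forall c, c \in C ->
     (wt c)%:Z \in [:: 0; Q ^+ (m - 1); w0;
                    w0 + s * Q ^+ ((m - 3) %/ 2); w0 - s * Q ^+ ((m - 3) %/ 2);
                    w0 - s * (Q - 1) * Q ^+ ((m - 3) %/ 2);
                    w0 + s * (Q - 1) * Q ^+ ((m - 3) %/ 2)]) /\
  freqz C 0 = 1%N /\
  freqz C (Q ^+ (m - 1)) = (q - 1)%N /\
  freqz C w0 = (q * (q ^ (m - 1) - 1))%N /\
  2 * (freqz C (w0 + s * Q ^+ ((m - 3) %/ 2)))%:Z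
    = (Q - 1) ^+ 2 * (Q ^+ (m - 1) + s * Q ^+ ((m - 1) %/ 2)) /\
  2 * (freqz C (w0 - s * Q ^+ ((m - 3) %/ 2)))%:Z
    = (Q - 1) ^+ 2 * (Q ^+ (m - 1) - s * Q ^+ ((m - 1) %/ 2)) /\
  2 * (freqz C (w0 - s * (Q - 1) * Q ^+ ((m - 3) %/ 2)))%:Z
    = (Q - 1) * (Q ^+ (m - 1) + s * Q ^+ ((m - 1) %/ 2)) /\
  2 * (freqz C (w0 + s * (Q - 1) * Q ^+ ((m - 3) %/ 2)))%:Z
    = (Q - 1) * (Q ^+ (m - 1) - s * Q ^+ ((m - 1) %/ 2)) /\
  ((3 < m)%N -> self_orthogonal C) /\
  is_nkd (dual_code C) (q ^ (m - 1) - m - 1) 3 /\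
  sphere_packing_rules_out q (q ^ (m - 1)) (q ^ (m - 1) - m - 1) 5.
Proof.
move=> l C s Q w0.
have oddF : odd #|F| by rewrite hF hq oddX hpodd orbT.
have cardL : #|L| = (#|F| ^ m)%N by rewrite hF.
have s1 : (s == 1) || (s == -1) by rewrite -eqf_sqr /s -signr_odd sqrr_sign expr1n.
have sN1 : (- s == 1) || (- s == -1) by rewrite eqr_oppLR eqr_opp orbC.
have q_gt0 : (0 < q)%N by rewrite -hF ltnW // card_gt1.
have q1 : (q - 1)%N%:Z = Q - 1 by rewrite subzn.
(* Passing from [s] to [- s] exchanges rows of the table together with their frequencies, so both
   signs are treated at once. *)
clearbody s; clear l hp hpodd he hq.
have [k mE] : exists k, m = (k * 2 + 3)%N by exists ((m - 3) %/ 2)%N; lia.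
have e3 : ((m - 3) %/ 2 = k)%N by lia.
have e1 : ((m - 1) %/ 2 = k.+1)%N by lia.
have [d d2] := quadric_signP iota cardL oddF hmodd.
rewrite e1 (expr_sub1E _ mE) => cardQ.
have w0E : w0 = Q ^+ k * ((Q - 1) * Q ^+ k.+1).
  have -> : w0 = (Q - 1) * Q ^+ (k + k.+1) by congr (_ * _ ^+ _); lia.
  by rewrite exprD; ring.
have topE : Q ^+ (m - 1) = Q ^+ k.+1 * Q ^+ k.+1 by rewrite (expr_sub1E _ mE).
have KE : Q ^+ k.+1 = Q * Q ^+ k by rewrite exprS.
have topE' : Q ^+ (m - 1) = Q ^+ k * (Q * Q ^+ k.+1) by rewrite topE KE; ring.
have cardD : #|Dset iota m| = (q ^ (m - 1))%N.
  apply/eqP; rewrite -eqz_nat (card_Dset cardQ) PoszX hF.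
  by rewrite -/Q topE.
have linC := lin_CDbar iota cardL oddF mE.
have [Q3 R1 _] := card_bounds k oddF; have QK := card_leK k oddF.
(* Both facts hold at either sign whatever [d] is; they are used at [s] and at [- s], so [d] and [s]
   are never compared. *)
have fplus := freq_plus1 cardL oddF mE d2 cardQ.
have fminus := freq_minusQ cardL oddF mE d2 cardQ.
rewrite hF -/Q in Q3 R1 QK fplus fminus.
rewrite e3 topE.
have dimC : code_dim C = (m + 1)%N.
  by apply: code_dim_card => //; apply: card_CDbar d2 cardQ.
have minE : ((q - 1) * q ^ k * (q ^ k.+1 - 1))%N%:Z =
    Q ^+ k * ((Q - 1) * Q ^+ k.+1 - 1 * (Q - 1)).
  have K1 : (q ^ k.+1 - 1)%N%:Z = Q ^+ k.+1 - 1.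
    by rewrite -PoszX subzn // expn_gt0 q_gt0.
  by rewrite !PoszM q1 K1 PoszX; ring.
split=> //; split; last split; last split; last split; last split;
  last split; last split; last split; last split; last split; last split.
- split=> //; split=> //; split=> [|u uC u0].
    (* The lower bound is a weight that occurs, its frequency at sign 1 being positive. *)
    have /card_gt0P[u] : (0 < freqz C (Q ^+ k * ((Q - 1) * Q ^+ k.+1 - 1 * (Q - 1))))%N.
      have := fminus 1 isT; rewrite lt0n; case: eqP => // ->.
      by move: (Q) (Q ^+ k.+1) Q3 QK => a b Q3 QK; clear -Q3 QK; nia.
    rewrite inE => /andP[uC /eqP wtu]; exists u => //.
    have wtu' : wt u = ((q - 1) * q ^ k * (q ^ k.+1 - 1))%N.
      by apply/eqP; rewrite -eqz_nat minE wtu.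
    rewrite wtu' eqxx andbT -wt_eq0 -eqz_nat wtu.
    rewrite mulf_neq0 //; first by rewrite gt_eqF // (lt_le_trans _ R1).
    by move: (Q) (Q ^+ k.+1) Q3 QK => a b Q3 QK; clear -Q3 QK; nia.
  rewrite -lez_nat minE mul1r; have := wt_CDbar_ge cardL oddF mE d2 cardQ uC u0.
  by rewrite hF.
- move=> u /(wt_CDbar cardL oddF mE d2 cardQ)[X ->].
  rewrite hF -/Q w0E KE !inE; move: (Q ^+ k) => R.
  case/orP: s1 => /eqP->;
    do 6?[case/orP]; move/eqP->;
    do 6?[apply/orP; first [left; apply/eqP; ring | right]]; apply/eqP; ring.
- by apply/eqP; rewrite -eqz_nat; apply/eqP; apply: freq_zero d2 cardQ.
- apply/eqP; rewrite -eqz_nat -topE topE' q1; apply/eqP.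
  by have := freq_top cardL oddF mE d2 cardQ; rewrite hF.
- apply/eqP; rewrite -eqz_nat w0E PoszM; apply/eqP.
  have -> : (q ^ (m - 1) - 1)%N%:Z = Q ^+ k.+1 * Q ^+ k.+1 - 1.
    by rewrite -topE -PoszX subzn // expn_gt0 q_gt0.
  by have := freq_mid cardL oddF mE d2 cardQ; rewrite hF.
- by rewrite -fplus // w0E; congr (2 * (freqz _ _)%:Z); ring.
- rewrite -[in RHS]mulNr -fplus // w0E; congr (2 * (freqz _ _)%:Z); ring.
- rewrite -fminus // w0E; congr (2 * (freqz _ _)%:Z); ring.
- rewrite -[in RHS]mulNr -fminus // w0E; congr (2 * (freqz _ _)%:Z); ring.
- move=> m3; apply: (self_orthogonal_CDbar cardL oddF mE d2 cardQ).
  by clear -m3 mE; lia.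
- split; first exact: lin_dual_code; split.
    apply: code_dim_card; first exact: lin_dual_code.
    by rewrite card_dual_code dimC cardD -subnDA.
  split=> [|u uC u0]; last exact: (dual_wt_ge3 cardL oddF mE uC u0).
  have [v vC v3] := dual_wt3 cardL oddF mE d2 cardQ.
  by exists v => //; rewrite -wt_eq0 v3.
- by apply: dual_sphere_packing; rewrite -?ltz_nat.
Qed.
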